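(* Let $f : \mathbb{R}^n \to \mathbb{R}^n$ be a homeomorphism of the form $$f(x) = \begin{cases} f_L(x), & x_1 \le 0, \\ f_R(x), & x_1 \ge 0, \end{cases}$$ where $f_L$ and $f_R$ are each smooth and defined throughout $\mathbb{R}^n$. Suppose $f$ has an invariant circle $C$ intersecting the switching manifold $x_1 = 0$ at exactly two points and $f|_C$ is degree-$1$. Then for any admissible $\mathcal{X}$-cycle on $C$ the word $\mathcal{X}$ is rotational.
   Context: Here $x = (x_1,\ldots,x_n)$, and the switching manifold of $f$ is the hyperplane $\{x \in \mathbb{R}^n : x_1 = 0\}$. An invariant circle of $f$ is a simple closed curve $C \subset \mathbb{R}^n$ with $f(C) = C$; the restriction of $f$ to $C$, denoted $f|_C$, is a circle map (after identifying $C$ with $\mathbb{S}^1$ by a homeomorphism). Represent $\mathbb{S}^1$ by $[0,1)$ with $1$ identified with $0$, and let $\pi(w) = w - \lfloor w \rfloor$ for $w \in \mathbb{R}$. A lift of a continuous map $g : \mathbb{S}^1 \to \mathbb{S}^1$ is a continuous function $G : \mathbb{R} \to \mathbb{R}$ with $\pi(G(w)) = g(\pi(w))$ for all $w \in \mathbb{R}$. The degree of $g$ is the integer $G(1) - G(0)$, which is independent of the lift. The degree of $f|_C$ is the degree of $\varphi \circ f|_C \circ \varphi^{-1}$ for a homeomorphism $\varphi : C \to \mathbb{S}^1$ (it does not depend on $\varphi$). Let $\Omega = \{L,R\}$ and let $p \ge 1$ be an integer. A word of length $p$ is an element $\mathcal{X} = \mathcal{X}_0 \mathcal{X}_1 \cdots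 \mathcal{X}_{p-1}$ of $\Omega^p$. An $\mathcal{X}$-cycle of $f$ is an ordered set $\{y^{(0)}, y^{(1)}, \ldots, y^{(p-1)}\}$ of points in $\mathbb{R}^n$ for which $f_{\mathcal{X}_0}(y^{(0)}) = y^{(1)}$, $f_{\mathcal{X}_1}(y^{(1)}) = y^{(2)}$, $\ldots$, $f_{\mathcal{X}_{p-1}}(y^{(p-1)}) = y^{(0)}$. An $\mathcal{X}$-cycle is admissible if $y^{(i)}_1 < 0$ for all $i$ for which $\mathcal{X}_i = L$, and $y^{(i)}_1 > 0$ for all $i$ for which $\mathcal{X}_i = R$, where $y^{(i)}_1$ is the first component of $y^{(i)}$. The shift map $\sigma : \Omega^p \to \Omega^p$ is defined by $\sigma(\mathcal{X}) = \mathcal{X}_1 \mathcal{X}_2 \cdots \mathcal{X}_{p-1} \mathcal{X}_0$. A word $\mathcal{Y}$ is a shift of another word $\mathcal{Z}$ if there exists an integer $i$ such that $\mathcal{Y} = \sigma^i(\mathcal{Z})$. For positive integers $\ell, m, p$ with $\ell < p$, $m < p$, and $m$ and $p$ coprime, the word $\mathcal{F}[\ell,m,p] \in \Omega^p$ is defined by $\mathcal{F}_i = L$ if $(i m \bmod p) < \ell$, and $\mathcal{F}_i = R$ otherwise, for $i = 0,\ldots,p-1$. A word $\mathcal{X}$ is rotational if it is a shift of some $\mathcal{F}[\ell,m,p]$.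
   Formalization: The word is additionally assumed to contain both L and R (a fixed point of the identity on the unit circle has word L, which is not rotational), and the p points of the cycle are taken to be distinct (a 2-cycle traversed twice gives LRLR, which is not rotational). *)

(* Defs.v *)
From HB Require Import structures.
From mathcomp Require Import all_boot all_order all_algebra.
From mathcomp Require Import all_classical all_reals all_analysis.
Import Order.TTheory GRing.Theory Num.Theory.
Import numFieldNormedType.Exports.

Set Implicit Arguments.
Unset Strict Implicit.
Unset Printing Implicit Defensive.

Local Open Scope classical_set_scope.
Local Open Scope ring_scope.

(* S^1 is the set [0,1[ with the quotient topology of R induced by
   w |-> w - floor w; in particular 1 is identified with 0. *)
Definition unit_interval01 (R : realType) : Type := {w : R | 0 <= w < 1}.

Lemma frac_subproof (R : realType) (w : R) :
  0 <= w - (Num.floor w)%:~R < 1.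
Proof.
by have := floor_itv w; rewrite intrD => /andP[w0 w1]; rewrite subr_ge0 w0 ltrBlDl.
Qed.

Definition frac_part (R : realType) (w : R) : unit_interval01 R :=
  exist _ (w - (Num.floor w)%:~R) (frac_subproof w).

Lemma val_frac_partK (R : realType) :
  cancel (fun s : unit_interval01 R => sval s) (@frac_part R).
Proof.
move=> [w w01]; apply: eq_exist => /=.
by rewrite (floor_def (m := 0)) ?subr0 ?add0r.
Qed.

HB.instance Definition _ (R : realType) :=
  isQuotient.Build R (unit_interval01 R) (@val_frac_partK R).

Definition circle (R : realType) : topologicalType :=
  quotient_topology (unit_interval01 R).

Definition circle_pi (R : realType) (w : R) : circle R := frac_part w.

Definition is_lift (R : realType) (g : circle R -> circle R) (G : R -> R) :=
  continuous G /\ forall w, circle_pi (G w) = g (circle_pi w).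

Definition has_degree (R : realType) (g : circle R -> circle R) (d : int) :=
  exists2 G : R -> R, is_lift g G & G 1 - G 0 = d%:~R.

(* phi, restricted to C with the subspace topology, is a homeomorphism from C
   onto the circle, with inverse psi. *)
Definition circle_homeo (R : realType) (T : topologicalType) (C : set T)
    (phi : T -> circle R) (psi : circle R -> T) :=
  [/\ {within C, continuous phi}, continuous psi,
      forall s, C (psi s),
      forall x, C x -> psi (phi x) = x &
      forall s, phi (psi s) = s].

Definition simple_closed_curve (R : realType) (T : topologicalType)
    (C : set T) :=
  exists (phi : T -> circle R) (psi : circle R -> T), circle_homeo C phi psi.

Definition invariant_circle (R : realType) (T : topologicalType) (f : T -> T)
    (C : set T) :=
  simple_closed_curve R C /\ f @` C = C.

(* The degree does not depend on the homeomorphism phi. *)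
Definition has_degree_on (R : realType) (T : topologicalType) (f : T -> T)
    (C : set T) (d : int) :=
  exists (phi : T -> circle R) (psi : circle R -> T),
    circle_homeo C phi psi /\ has_degree (phi \o f \o psi) d.

Definition homeomorphism (T U : topologicalType) (f : T -> U) :=
  exists g : U -> T,
    [/\ continuous f, continuous g, cancel f g & cancel g f].

(* C^oo: the partial derivatives of all orders exist and are continuous. *)
Definition partial_derive (R : realType) (n m : nat) (i : 'I_n.+1)
    (f : 'rV[R]_n.+1 -> 'rV[R]_m.+1) : 'rV[R]_n.+1 -> 'rV[R]_m.+1 :=
  fun x => 'D_(delta_mx 0 i) f x.

Definition iter_partial (R : realType) (n m : nat) (s : seq 'I_n.+1)
    (f : 'rV[R]_n.+1 -> 'rV[R]_m.+1) : 'rV[R]_n.+1 -> 'rV[R]_m.+1 :=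
  foldr (fun i h => partial_derive i h) f s.

Definition smooth (R : realType) (n m : nat)
    (f : 'rV[R]_n.+1 -> 'rV[R]_m.+1) :=
  forall s : seq 'I_n.+1,
    continuous (iter_partial s f) /\
    forall (i : 'I_n.+1) (x : 'rV[R]_n.+1),
      derivable (iter_partial s f) x (delta_mx 0 i).

(* The first component x_1 of x has index 0. *)
Definition coord1 (R : realType) (n : nat) (x : 'rV[R]_n.+1) : R := x 0 0.

Definition switching_manifold (R : realType) (n : nat) : set 'rV[R]_n.+1 :=
  [set x | coord1 x = 0].

Inductive letter := letterL | letterR.

Definition word (p : nat) : Type := p.-tuple letter.

Definition shift (p : nat) (X : word p) : word p := rot_tuple 1 X.

(* Natural exponents suffice, as shift has order dividing p on words of
   length p. *)
Definition is_shift (p : nat) (Y Z : word p) :=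
  exists i : nat, Y = iter i (@shift p) Z.

Definition rot_word (l m p : nat) : word p :=
  [tuple (if ((i * m) %% p < l)%N then letterL else letterR) | i < p].

Definition rotational (p : nat) (X : word p) :=
  exists l m : nat,
    [/\ (0 < l < p)%N, (0 < m < p)%N, coprime m p & is_shift X (rot_word l m p)].

Definition branch (T : Type) (fL fR : T -> T) (a : letter) : T -> T :=
  match a with letterL => fL | letterR => fR end.

(* Injectivity: a cycle of a word of length p is a set of p points, so a
   shorter cycle traversed several times does not count. *)
Definition is_cycle (T : Type) (fL fR : T -> T) (p : nat) (X : word p)
    (y : 'I_p -> T) :=
  injective y /\
  forall i : 'I_p, branch fL fR (tnth X i) (y i) = y (ordS i).

Definition admissible (R : realType) (n p : nat) (X : word p)
    (y : 'I_p -> 'rV[R]_n.+1) :=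
  forall i : 'I_p,
    (tnth X i = letterL -> coord1 (y i) < 0) /\
    (tnth X i = letterR -> 0 < coord1 (y i)).

(* Main.v *)
Require Import Defs.
From mathcomp Require Import all_boot all_order all_algebra.
From mathcomp Require Import all_classical all_reals all_analysis.
From mathcomp Require Import zify ring lra.
Import Order.TTheory GRing.Theory Num.Theory.
Import numFieldNormedType.Exports.
Set Implicit Arguments.
Unset Strict Implicit.
Unset Printing Implicit Defensive.

Local Open Scope classical_set_scope.
Local Open Scope ring_scope.

(* A degree-one lift G of f on C is injective and commutes with integer
   translations, so it is increasing.  Cut the circle at the zero of x_1 where
   it becomes negative: the cycle gets lifts t_i in a unit interval ]a, a + 1[,
   and the letter L marks the t_i below the other zero b.
   The function K x = \sum_j ceil (x - t_j) counts, with sign, the integer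
   translates of the t_j below x.  It takes the value K (t_i) = rank of t_i, and
   K (G x) = K x + M for a constant M because G permutes these translates in
   order.  As G (t_i) is an integer translate of t_(i+1), one step of the cycle
   adds M to the rank modulo p. *)

(** * Degree-one lifts: integer translations and monotonicity *)

Lemma circle_pi_intD (R : realType) (w : R) (k : int) :
  circle_pi (w + k%:~R) = circle_pi w.
Proof.
apply: eq_exist => /=.
by rewrite floorDrz ?intr_int // intrKfloor intrD opprD addrACA subrr addr0.
Qed.

Lemma circle_pi_eq (R : realType) (u v : R) :
  circle_pi u = circle_pi v -> exists k : int, u = v + k%:~R.
Proof.
case=> /= uv; exists (Num.floor u - Num.floor v).
by rewrite intrB; lra.
Qed.

Lemma circle_pi_sval (R : realType) (s : circle R) :
  circle_pi (sval (s : unit_interval01 R)) = s.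
Proof. exact: val_frac_partK. Qed.

Lemma circle_pi_continuous (R : realType) : continuous (@circle_pi R).
Proof.
have -> : @circle_pi R = \pi_(circle R)%qT by rewrite unlock.
exact: pi_continuous.
Qed.

Lemma intD_equivariant (R : realType) (G : R -> R) :
  (forall w, G (w + 1) = G w + 1) ->
  forall w (k : int), G (w + k%:~R) = G w + k%:~R.
Proof.
move=> G1; have Gn w (n : nat) : G (w + n%:R) = G w + n%:R.
  by elim: n => [|n IHn]; rewrite ?addr0 // -natr1 !addrA G1 IHn.
move=> w [n|n]; first exact: Gn.
by rewrite NegzE mulrNz; apply/eqP; rewrite -subr_eq opprK -Gn subrK.
Qed.

Lemma int_valued_continuous_cst (R : realType) (D : R -> R) :
  continuous D -> (forall w, exists k : int, D w = k%:~R) ->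
  forall u v, D u = D v.
Proof.
move=> Dc Dint.
(* A gap between two integer values would be filled by a half-integer. *)
have noIVT a b (k : int) : a <= b ->
    Num.min (D a) (D b) <= k%:~R + 2^-1 <= Num.max (D a) (D b) -> False.
  move=> ab vD; have [|c _ Dcv] := IVT ab _ vD; first exact: continuous_subspaceT.
  have [l Dl] := Dint c; move: Dcv; rewrite Dl => /(congr1 (fun x => x - k%:~R)).
  rewrite -intrB addrAC subrr add0r => E.
  have : (0 : int) < l - k < 1 by rewrite -(ltr_int R) -(ltr_int R _ 1) E; lra.
  by lia.
have noltD u v : D u < D v -> False.
  have [k Ek] := Dint u; have [l El] := Dint v.
  rewrite Ek El ltr_int -lezD1 -(ler_int R) intrD => kl.
  have [uv|/ltW vu] := leP u v.
    by apply: (noIVT u v k uv); rewrite Ek El ge_min le_max; apply/andP; split; apply/orP; lra.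
  by apply: (noIVT v u k vu); rewrite Ek El ge_min le_max; apply/andP; split; apply/orP; lra.
by move=> u v; apply/eqP; case: ltgtP => // /noltD.
Qed.

(** The difference [G (v + 1) - G v] is continuous and integer-valued, hence constant, and at
    [v = 0] it is the degree. *)
Lemma degree1_lift_intD (R : realType) (g : circle R -> circle R) (G : R -> R) :
  is_lift g G -> G 1 - G 0 = 1 ->
  forall w (k : int), G (w + k%:~R) = G w + k%:~R.
Proof.
move=> [Gc GE] G01; apply: intD_equivariant => w.
suff : G (w + 1) - G w = G (0 + 1) - G 0 by rewrite add0r G01; lra.
pose D v := G (v + 1) - G v.
apply: (@int_valued_continuous_cst R D) => v.
  apply: cvgB; last exact: Gc.
  apply: (cvg_comp (fun v => v + 1) G); last exact: Gc.
  by apply: cvgD; [exact: cvg_id|exact: cvg_cst].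
have /circle_pi_eq [k Ek] : circle_pi (G (v + 1)) = circle_pi (G v).
  by rewrite !GE (circle_pi_intD v 1).
by exists k; rewrite /D Ek addrC addKr.
Qed.

(** Points with equal image under [G] differ by an integer because [g] is injective, and
    equivariance makes that integer zero. So [G] is continuous and injective, hence strictly
    monotone. *)
Lemma degree1_lift_mono (R : realType) (g : circle R -> circle R) (G : R -> R) :
  injective g -> is_lift g G -> G 1 - G 0 = 1 -> {mono G : u v / u <= v}.
Proof.
move=> ginj Glift G01; have GD := degree1_lift_intD Glift G01.
have [Gc GE] := Glift.
have Ginj : injective G.
  move=> u v Guv; have /circle_pi_eq [k Ek] : circle_pi u = circle_pi v.
    by apply: ginj; rewrite -!GE Guv.
  move: Guv; rewrite Ek GD => /eqP; rewrite addrC -subr_eq0 addrK => /eqP ->.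
  by rewrite addr0.
have GI : {in `]-oo, +oo[ &, {mono G : u v / u <= v}}.
  (* The degree gives [G 0 < G 1], which rules out a decreasing [G]. *)
  apply: itv_continuous_inj_le; first exists 0, 1.
  - by rewrite !in_itv /=; split => //; lra.
  - exact: continuous_subspaceT.
  - by move=> u v _ _; exact: Ginj.
by move=> u v; apply: GI; rewrite in_itv.
Qed.

(** * Signs of a periodic function with two zeros per period *)

Lemma no_zero_itv_sign (R : realType) (h : R -> R) (a b : R) :
  continuous h -> (forall w, a < w < b -> h w != 0) ->
  (forall w, a < w < b -> h w < 0) \/ (forall w, a < w < b -> 0 < h w).
Proof.
move=> hc hn0.
have opp u v : a < u < b -> a < v < b -> h u < 0 -> 0 < h v -> False.
  move=> uab vab hu hv.
  have noIVT x y : a < x -> y < b -> x <= y ->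
     Num.min (h x) (h y) <= 0 <= Num.max (h x) (h y) -> False.
    move=> ax yb xy h0; have [|c] := IVT xy _ h0.
      exact: continuous_subspaceT.
    rewrite in_itv /= => cxy /eqP; apply/negP/hn0; lra.
  have [uv|/ltW vu] := leP u v.
    apply: (noIVT u v) => //; first [lra | by rewrite ge_min le_max (ltW hu) (ltW hv) orbT].
  apply: (noIVT v u) => //; first [lra | by rewrite ge_min le_max (ltW hu) (ltW hv) orbT].
have [[u [uab hu]]|noneg] := pselect (exists u, a < u < b /\ h u < 0).
  left=> w wab; have := hn0 w wab; rewrite neq_lt => /orP[//|hw].
  by case: (opp u w).
right=> w wab; have := hn0 w wab; rewrite neq_lt => /orP[hw|//].
by case: noneg; exists w.
Qed.

(** Each of the two arcs between zeros has constant sign. Since both signs occur, the arcs have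
    opposite signs, and the period can be made to start with the negative one. *)
Lemma periodic_two_zeros_sign (R : realType) (h : R -> R) (a b : R) :
  continuous h -> (forall w (k : int), h (w + k%:~R) = h w) ->
  a < b < a + 1 -> h a = 0 -> h b = 0 ->
  (forall w, a < w < a + 1 -> h w = 0 -> w = b) ->
  (exists u, h u < 0) -> (exists v, 0 < h v) ->
  exists a' b', [/\ a' < b' < a' + 1, h a' = 0, h b' = 0,
    forall w, a' < w < b' -> h w < 0 & forall w, b' < w < a' + 1 -> 0 < h w].
Proof.
move=> hc hD ab ha hb h0 [u hu] [v hv].
(* The floor brings [w] into [[a, a + 1[]; the endpoint [a] is excluded because [h] vanishes
   there. *)
have shiftD w : h w != 0 -> exists2 w', a < w' < a + 1 & h w' = h w.
  move=> hw; pose k := Num.floor (w - a); exists (w + (- k)%:~R); last exact: hD.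
  have /andP[] := floor_itv (w - a); rewrite -/k intrD mulrNz le_eqVlt.
  case/orP => [/eqP E|]; last by rewrite mulr1z; lra.
  have wk : w + (- k)%:~R = a by rewrite mulrNz; lra.
  by move: hw; rewrite -(hD w (- k)) wk ha eqxx.
have [u' u'a hu'] := shiftD u (ltr0_neq0 hu); rewrite -{}hu' in hu.
have [v' v'a hv'] := shiftD v (lt0r_neq0 hv); rewrite -{}hv' in hv.
have h1 : forall w, a < w < b -> h w != 0.
  by move=> w wab; apply/eqP => /h0; lra.
have h2 : forall w, b < w < a + 1 -> h w != 0.
  by move=> w wab; apply/eqP => /h0; lra.
have u'b : u' != b by apply: contraTneq hu => ->; rewrite hb ltxx.
have v'b : v' != b by apply: contraTneq hv => ->; rewrite hb ltxx.
have [s1|s1] := no_zero_itv_sign hc h1; have [s2|s2] := no_zero_itv_sign hc h2.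
- case: (ltgtP v' b) v'b => // v'b _.
    by have := s1 v'; lra.
  by have := s2 v'; lra.
- by exists a, b.
(* The negative arc comes second, so the period is restarted at [b]. *)
- exists b, (a + 1); split => //; first by lra.
    by rewrite (hD a 1).
  move=> w wb; rewrite -(hD w (-1)); apply: s1.
  by rewrite mulrNz; lra.
- case: (ltgtP u' b) u'b => // u'b _.
    by have := s1 u'; lra.
  by have := s2 u'; lra.
Qed.

(** * Counting integer translates, and ranks *)

Lemma sum_ceil_rotation (R : realType) (p : nat) (s : 'I_p -> 'I_p)
    (t : 'I_p -> R) (k : 'I_p -> int) (G : R -> R) :
  {mono G : u v / u <= v} -> (forall w (l : int), G (w + l%:~R) = G w + l%:~R) ->
  injective s -> (forall i, G (t i) = t (s i) + (k i)%:~R) ->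
  forall i, \sum_j Num.ceil (t (s i) - t j) =
    \sum_j Num.ceil (t i - t j) + \sum_j k j - (k i) *+ p.
Proof.
move=> Gmono GD sinj Gt i.
(* The ceiling of [z - w] is determined by the comparisons [z <= w + l] with [l] an integer, and [G]
   preserves all of these. *)
have ceilG z w : Num.ceil (G z - G w) = Num.ceil (z - w).
  have le_ceilG l : (Num.ceil (G z - G w) <= l) = (Num.ceil (z - w) <= l).
    by rewrite !ceil_le_int !lerBlDl -GD Gmono.
  by apply/eqP; rewrite eq_le le_ceilG lexx -le_ceilG lexx.
have -> : k i *+ p = \sum_(j < p) k i by rewrite sumr_const card_ord.
rewrite (reindex_inj sinj) -big_split /= -sumrB.
apply: eq_bigr => j _; rewrite -[Num.ceil (t i - t j)]ceilG !Gt.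
rewrite (_ : t (s i) + _ - _ = t (s i) - t (s j) + (k i - k j)%:~R); last first.
  by rewrite intrB; ring.
by rewrite (ceilDrz (t (s i) - t (s j)) (intr_int _ _)) intrKceil; ring.
Qed.

(** All differences lie in []-1, 1[], so each ceiling is 1 when [t j < t i] and 0 otherwise. *)
Lemma sum_ceil_rank (R : realType) (p : nat) (t : 'I_p -> R) :
  (forall i j, t i < t j + 1) ->
  forall i, \sum_j Num.ceil (t i - t j) = #|[pred j | t j < t i]|%:Z.
Proof.
move=> t1 i; rewrite -sum1_card -[RHS]natz natr_sum [RHS]big_mkcond /=.
apply: eq_bigr => j _; rewrite unfold_in /=; apply: ceil_def.
have tij := t1 i j; have tji := t1 j i.
by case: (ltP (t j) (t i)) => ij; rewrite ?intrB ?mulr1z ?mulr0z; lra.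
Qed.

Lemma rank_inj (R : realType) (p : nat) (t : 'I_p -> R) :
  injective t -> injective (fun i => #|[pred j | t j < t i]|).
Proof.
move=> tinj i j /= Eij; apply: tinj.
have ltr (u v : 'I_p) : t u < t v ->
    (#|[pred j | (t j < t u)%R]| < #|[pred j | (t j < t v)%R]|)%N.
  move=> uv; apply: proper_card; apply/properP; split.
    by apply/fintype.subsetP => w; rewrite !inE => /lt_trans; apply.
  by exists u; rewrite inE // ltxx.
by apply/eqP; case: ltgtP => // /ltr; rewrite Eij ltnn.
Qed.

(** Turns a position relative to the cut [b] into the threshold on ranks that defines the letters of
    [rot_word]. *)
Lemma rank_lt_card (R : realType) (p : nat) (t : 'I_p -> R) (b : R) i :
  (#|[pred j | (t j < t i)%R]| < #|[pred j | (t j < b)%R]|)%N = (t i < b).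
Proof.
have [ib|bi] := ltP (t i) b.
  apply: proper_card; apply/properP; split.
    by apply/fintype.subsetP => w; rewrite !inE => /lt_trans; apply.
  by exists i; rewrite inE // ltxx.
apply/negbTE; rewrite -leqNgt; apply: subset_leq_card.
by apply/fintype.subsetP => w; rewrite !inE => /lt_le_trans; apply.
Qed.

(** * From ranks to rotational words *)

Lemma nth_iter_shift (p k i : nat) (Z : word p) (d : letter) : (i < p)%N ->
  nth d (iter k (@Defs.shift p) Z) i = nth d Z ((i + k) %% p)%N.
Proof.
elim: k i => [|k IHk] i ip; first by rewrite addn0 modn_small.
rewrite iterS /= /rot nth_cat size_drop size_tuple.
have [i1|i1] := ltnP i (p - 1)%N.
  by rewrite nth_drop IHk; [congr nth; congr modn; lia|lia].
rewrite nth_take ?IHk; [|lia..].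
have -> : (i - (p - 1) = 0)%N by lia.
by rewrite add0n addnS -addSn (_ : i.+1 = p) ?modnDl //; lia.
Qed.

Lemma nth_rot_word (l m p i : nat) (d : letter) : (i < p)%N ->
  nth d (rot_word l m p) i =
    if ((i * m) %% p < l)%N then letterL else letterR.
Proof.
by move=> ip; have := tnth_mktuple
  (fun i : 'I_p => if ((i * m) %% p < l)%N then letterL else letterR)
  (Ordinal ip); rewrite (tnth_nth d).
Qed.

(** The ranks run through all residues in steps of [m]. Counting indices from the point [z] of rank
    0 gives rank [(i - z) * m] modulo [p], so [X] is a rotational word shifted by [- z]. *)
Lemma rotational_of_rank (p l m : nat) (X : word p) (r : 'I_p -> nat) :
  (0 < l < p)%N -> injective r -> (forall i, (r i < p)%N) ->
  (forall i, r (ordS i) = r i + m %[mod p])%N ->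
  (forall i, tnth X i = if (r i < l)%N then letterL else letterR) ->
  rotational X.
Proof.
move=> l0p rinj rp rS rX.
have p1 : (1 < p)%N by lia.
have p0 : (0 < p)%N by lia.
have ronto a : (a < p)%N -> exists i, r i = a.
  move=> ap; pose r' i := Ordinal (rp i).
  have r'inj : injective r' by move=> i j [/rinj].
  have [s _ sK] := injF_bij r'inj.
  by exists (s (Ordinal ap)); have := congr1 val (sK (Ordinal ap)).
have r0 (i : 'I_p) : (r i = r (Ordinal p0) + i * m %[mod p])%N.
  case: i; elim=> [|i IHi] ip.
    by rewrite mul0n addn0; congr (r _ %% p)%N; apply: val_inj.
  have -> : Ordinal ip = ordS (Ordinal (ltnW ip)).
    by apply: val_inj; rewrite /= modn_small.
  by rewrite rS -modnDml IHi modnDml /= (modn_small ip) mulSn -addnA (addnC m).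
have [z rz] := ronto 0 p0.
have rz0 : ((r (Ordinal p0) + z * m) %% p = 0)%N by rewrite -r0 rz mod0n.
(* Here [p - z] stands for [- z] modulo [p], to stay within the naturals. *)
have rE (i : 'I_p) : (r i = (i + (p - z)) * m %% p)%N.
  rewrite -(modn_small (rp i)) r0 -(modnMDl m).
  have -> : (m * p + (r (Ordinal p0) + i * m) =
             (r (Ordinal p0) + z * m) + (i + (p - z)) * m)%N.
    by rewrite -{1}(subnKC (ltnW (ltn_ord z))); ring.
  by rewrite -modnDml rz0 add0n.
(* The point of rank 1 provides an inverse of [m] modulo [p]; hence [m %% p] is nonzero and coprime
   to [p]. *)
have [u ru] := ronto 1 p1.
have m1 : ((u + (p - z)) * (m %% p) %% p = 1)%N by rewrite modnMmr -rE.
exists l, (m %% p)%N; split=> //.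
- rewrite ltn_mod p0 andbT lt0n; apply: contra_eq_neq m1 => ->.
  by rewrite muln0 mod0n.
- have : coprime ((u + (p - z)) * (m %% p)) p.
    by rewrite -coprime_modl m1 coprime1n.
  by rewrite coprimeMl => /andP[].
- exists (p - z)%N; apply: eq_from_tnth => i.
  rewrite rX (tnth_nth letterL) nth_iter_shift // nth_rot_word ?ltn_mod //.
  by rewrite modnMml modnMmr -rE.
Qed.

(** * The cycle on the invariant circle, lifted to the line *)

Theorem theorem3p4 (R : realType) (n : nat)
    (f fL fR : 'rV[R]_n.+1 -> 'rV[R]_n.+1)
    (f_homeo : homeomorphism f)
    (fL_smooth : smooth fL) (fR_smooth : smooth fR)
    (f_left : forall x, coord1 x <= 0 -> f x = fL x)
    (f_right : forall x, 0 <= coord1 x -> f x = fR x)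
    (C : set 'rV[R]_n.+1)
    (C_inv : invariant_circle R f C)
    (C_two : exists a b : 'rV[R]_n.+1,
       a <> b /\ C `&` @switching_manifold R n = [set a; b])
    (C_degree : has_degree_on R f C 1)
    (p : nat) (p_ge1 : (1 <= p)%N) (X : word p) (y : 'I_p -> 'rV[R]_n.+1)
    (y_cycle : is_cycle fL fR X y)
    (y_admissible : admissible X y)
    (y_on_C : forall i, C (y i))
    (X_has_L : exists i, tnth X i = letterL)
    (X_has_R : exists i, tnth X i = letterR) :
  rotational X.

Proof.
have [phi [psi [[_ psi_c psiC phiK psiK] [G Glift G01]]]] := C_degree.
have [_ fC] := C_inv.
have [f' [f_c _ fK _]] := f_homeo.
have [y_inj y_next] := y_cycle.
pose g := phi \o f \o psi.
have fpsiC s : C (f (psi s)) by rewrite -fC; exists (psi s).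
have g_inj : injective g.
  move=> u v /(congr1 psi); rewrite /g /= !phiK // => /(can_inj fK).
  by move=> /(congr1 phi); rewrite !psiK.
have Gmono : {mono G : u v / u <= v} := degree1_lift_mono g_inj Glift G01.
have GD := degree1_lift_intD Glift G01.
(* The first coordinate along [C], as a 1-periodic function of the lifted angle. *)
pose h w := coord1 (psi (circle_pi w)).
have hc : continuous h.
  move=> w; apply: (cvg_comp (psi \o @circle_pi R) (@coord1 R n)); last first.
    exact: coord_continuous.
  apply: (cvg_comp (@circle_pi R) psi); last exact: psi_c.
  exact: circle_pi_continuous.
have hD w (k : int) : h (w + k%:~R) = h w by rewrite /h circle_pi_intD.
pose rep x : R := sval (phi x : unit_interval01 R).
have repK x : C x -> psi (circle_pi (rep x)) = x.
  by move=> Cx; rewrite circle_pi_sval phiK.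
have rep01 x : 0 <= rep x < 1 by exact: (svalP (phi x : unit_interval01 R)).
have hrep x : C x -> h (rep x) = coord1 x by move=> Cx; rewrite /h repK.
have [a0 [b0 [a0b0 ha0 hb0 h0]]] : exists a b, [/\ a < b < a + 1,
    h a = 0, h b = 0 & forall w, a < w < a + 1 -> h w = 0 -> w = b].
  have [a [b [ab Cab]]] := C_two.
  wlog lt_ab : a b ab Cab / rep a < rep b.
    move=> wl; have aC : C a by have [] : (C `&` @switching_manifold R n) a
      by rewrite Cab; left.
    have bC : C b by have [] : (C `&` @switching_manifold R n) b
      by rewrite Cab; right.
    case: (ltgtP (rep a) (rep b)) => [||E]; first exact: wl.
      by apply: wl; [exact/nesym|rewrite Cab setUC].
    by case: ab; rewrite -(repK a) // E repK.
  have [aC a0] : (C `&` @switching_manifold R n) a by rewrite Cab; left.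
  have [bC b0] : (C `&` @switching_manifold R n) b by rewrite Cab; right.
  have a01 := rep01 a; have b01 := rep01 b.
  exists (rep a), (rep b); split; rewrite ?hrep //; first by lra.
  move=> w wab hw.
  have : (C `&` @switching_manifold R n) (psi (circle_pi w)) by split.
  (* A zero lies over [a] or over [b]. No translate of [rep a] is strictly between [rep a] and
     [rep a + 1], and the only translate of [rep b] there is [rep b] itself. *)
  rewrite Cab => -[] /= Ew.
    have /circle_pi_eq [k wk] : circle_pi w = circle_pi (rep a).
      by rewrite circle_pi_sval -Ew psiK.
    have : (0 : int) < k < 1 by rewrite -(ltr_int R) -(ltr_int R _ 1); lra.
    by lia.
  have /circle_pi_eq [k wk] : circle_pi w = circle_pi (rep b).
    by rewrite circle_pi_sval -Ew psiK.
  have : (-1 : int) < k < 1 by rewrite -(ltr_int R) -(ltr_int R _ 1); lra.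
  by move=> k1; rewrite wk (_ : k = 0) ?addr0 //; lia.
have [] := periodic_two_zeros_sign hc hD a0b0 ha0 hb0 h0.
- have [i /(proj1 (y_admissible i)) yi] := X_has_L.
  by exists (rep (y i)); rewrite hrep.
- have [i /(proj2 (y_admissible i)) yi] := X_has_R.
  by exists (rep (y i)); rewrite hrep.
move=> a [b [ab ha hb hneg hpos]].
(* The translate of the angle of [y i] that lies in [[a, a + 1[]. *)
pose t i := rep (y i) + (- Num.floor (rep (y i) - a))%:~R.
have ht i : h (t i) = coord1 (y i) by rewrite hD hrep.
have y_neq0 i : coord1 (y i) != 0.
  have [yL yR] := y_admissible i.
  by case: (tnth X i) yL yR => [/(_ erefl)/ltr0_neq0|_ /(_ erefl)/lt0r_neq0].
have t_itv i : a < t i < a + 1.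
  have tia : t i != a by apply: contraNneq (y_neq0 i) => E; rewrite -ht E ha.
  have := floor_itv (rep (y i) - a); rewrite intrD mulr1z => fl.
  rewrite lt_neqAle eq_sym tia /= /t mulrNz; lra.
have pi_t i : circle_pi (t i) = phi (y i) by rewrite circle_pi_intD circle_pi_sval.
have t_inj : injective t.
  move=> i j tij; apply: y_inj.
  by rewrite -(phiK (y i)) // -(phiK (y j)) // -!pi_t tij.
have tb i : (t i < b) = (if tnth X i is letterL then true else false).
  have [yL yR] := y_admissible i; have tiab := t_itv i.
  have tib : t i != b by apply: contraNneq (y_neq0 i) => E; rewrite -ht E hb.
  case: (tnth X i) yL yR => [/(_ erefl) yi _|_ /(_ erefl) yi].
    by rewrite ltNge le_eqVlt eq_sym (negPf tib) /=; apply/negP => bt;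
      have := hpos (t i); rewrite ht; lra.
  apply/negP => bt; have := hneg (t i); rewrite ht; lra.
(* By admissibility the branch named by each letter agrees with [f] at that point. *)
have f_y i : f (y i) = y (ordS i).
  rewrite -y_next; have [yL yR] := y_admissible i.
  case: (tnth X i) yL yR => /= [/(_ erefl) yi _|_ /(_ erefl) yi].
    exact/f_left/ltW.
  exact/f_right/ltW.
have G_t i : exists k : int, G (t i) = t (ordS i) + k%:~R.
  by apply: circle_pi_eq; rewrite (proj2 Glift) !pi_t /= phiK // f_y.
have [k Gk] := choice G_t.
have t1 i j : t i < t j + 1 by have := t_itv i; have := t_itv j; lra.
pose r i := #|[pred j | t j < t i]|.
pose M : int := \sum_j k j.
(* [M] may be negative, so its nonnegative residue serves as the step. *)
pose m := `|(M %% p)%Z|%N.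
have p0 : (0 < p)%N by [].
have r_lt i : (r i < p)%N.
  rewrite -[X in (_ < X)%N](card_ord p); apply: proper_card; apply/properP; split.
    exact/fintype.subsetP.
  by exists i; rewrite inE // ltxx.
(* The threshold is the number of letters [L]; it is strictly between 0 and [p] because both letters
   occur. *)
apply: (@rotational_of_rank p #|[pred j | t j < b]| m X r) => //.
- have [iL XL] := X_has_L; have [iR XR] := X_has_R.
  apply/andP; split; first by apply/card_gt0P; exists iL; rewrite inE tb XL.
  rewrite -[X in (_ < X)%N](card_ord p); apply: proper_card; apply/properP; split.
    exact/fintype.subsetP.
  by exists iR; rewrite // inE tb XR.
- exact: rank_inj.
- move=> i; have := sum_ceil_rotation Gmono GD (@ordS_inj p) Gk i.
  rewrite !sum_ceil_rank // -/M -/(r _) -/(r _) => rE.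
  suff /eqP : (r (ordS i) == (r i + m)%N %[mod p])%Z.
    by rewrite !modz_nat => -[].
  (* The rank changes by [M - k i * p], so removing the residue of [M] leaves this multiple of
     [p]. *)
  rewrite eqz_mod_dvd; apply/dvdzP; exists ((M %/ p)%Z - k i).
  rewrite rE {1}(divz_eq M p) PoszD /m gez0_abs ?modz_ge0 //; last by lia.
  by ring.
- by move=> i; rewrite rank_lt_card tb; case: (tnth X i).
Qed.
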